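(* Let $\mathcal{A} = (A,E)$ be a digraph having local finite height. Then there is an elementary extension $\mathcal{B} \succ \mathcal{A}$ (in the first-order language with the single binary relation symbol $E$) such that $\mathcal{B}$ has a kernel.
   Context: A digraph is a structure $\mathcal{A} = (A,E)$ where $E$ is an arbitrary binary relation on $A$ (finite or infinite). A subset $B \subseteq A$ is identified with the induced subdigraph $(B, E \cap B^2)$. A subset $K \subseteq A$ is a kernel of $\mathcal{A}$ if for every $a \in A$: $a \in K$ if and only if for all $b \in A$, $aEb$ implies $b \notin K$. For $n < \omega$, the relation $E^n$ on $A$ is defined by recursion: $xE^0y$ iff $x=y$; $xE^{n+1}y$ iff there is $z \in A$ with $xEz$ and $zE^ny$. A digraph $\mathcal{A}$ has finite height if there is $k < \omega$ such that there are no $a,b \in A$ with $aE^{k+1}b$; in that case its height $\mathrm{ht}(\mathcal{A})$ is the least such $k$. For $X \subseteq A$ and $k < \omega$, define by recursion $\mathrm{Cl}^{\mathcal{A}}_0(X) = X$ and $\mathrm{Cl}^{\mathcal{A}}_{k+1}(X) = X \cup \{a \in A : dEa \text{ for some } d \in \mathrm{Cl}^{\mathcal{A}}_k(X)\}$. A digraph $\mathcal{A}$ has local finite height if for every $m < \omega$ there is $k < \omega$ such that for every $F \subseteq A$ of cardinality at most $m$, the induced subdigraph on $\mathrm{Cl}^{\mathcal{A}}_m(F)$ has finite height and $\mathrm{ht}(\mathrm{Cl}^{\mathcal{A}}_m(F)) \leq k$. *)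

(* Defs.v *)
From mathcomp Require Import all_boot.
From mathcomp Require Import boolp classical_sets cardinality.

Set Implicit Arguments.
Unset Strict Implicit.
Unset Printing Implicit Defensive.

Local Open Scope classical_set_scope.
Local Open Scope card_scope.

Record digraph := Digraph {
  vertex :> Type;
  edge : vertex -> vertex -> Prop
}.

Definition induced (A : digraph) (B : set A) : digraph :=
  @Digraph {x : A | B x} (fun x y => edge (proj1_sig x) (proj1_sig y)).

Definition kernel (A : digraph) (K : set A) : Prop :=
  forall a : A, K a <-> (forall b : A, edge a b -> ~ K b).

Fixpoint edge_pow (A : digraph) (n : nat) (x y : A) : Prop :=
  if n is n'.+1 then exists z : A, edge x z /\ edge_pow n' z y else x = y.

Definition height_bound (A : digraph) (k : nat) : Prop :=
  ~ exists a b : A, edge_pow k.+1 a b.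

Definition has_height (A : digraph) (h : nat) : Prop :=
  height_bound A h /\ forall k, height_bound A k -> h <= k.

Fixpoint Cl (A : digraph) (k : nat) (X : set A) : set A :=
  if k is k'.+1 then X `|` [set a | exists2 d, Cl k' X d & edge d a] else X.

(* "Finite height" is the existence of some h with [has_height _ h]. *)
Definition local_finite_height (A : digraph) : Prop :=
  forall m : nat, exists k : nat, forall F : set A, F #<= `I_m ->
    exists2 h, has_height (induced (Cl m F)) h & h <= k.

(* First-order formulas with equality over one binary relation symbol, with
   free variables among 'I_n.  The index [ord0] is the variable bound by the
   innermost quantifier.  The remaining connectives and the existential
   quantifier are classically definable. *)
Inductive formula : nat -> Type :=
| Bot n : formula n
| Eq n : 'I_n -> 'I_n -> formula n
| Rel n : 'I_n -> 'I_n -> formula n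
| Imp n : formula n -> formula n -> formula n
| All n : formula n.+1 -> formula n.

Definition env_cons (T : Type) (n : nat) (x : T) (e : 'I_n -> T) :
    'I_n.+1 -> T :=
  fun i => if unlift ord0 i is Some j then e j else x.

Fixpoint sat (A : digraph) (n : nat) (phi : formula n) :
    ('I_n -> A) -> Prop :=
  match phi in formula n return ('I_n -> A) -> Prop with
  | Bot _ => fun _ => False
  | Eq _ i j => fun e => e i = e j
  | Rel _ i j => fun e => edge (e i) (e j)
  | Imp _ p q => fun e => sat p e -> sat q e
  | All _ p => fun e => forall x : A, sat p (env_cons x e)
  end.

Definition elementary_embedding (A B : digraph) (f : A -> B) : Prop :=
  forall (n : nat) (phi : formula n) (e : 'I_n -> A),
    sat phi e <-> sat phi (fun i => f (e i)).

(* A is identified with its image in B; injectivity and preservation and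
   reflection of edges are the atomic cases of elementarity. *)
Definition elementary_extension (A B : digraph) : Prop :=
  exists f : A -> B, elementary_embedding f.

(* Main.v *)
Require Import Defs.
From mathcomp Require Import all_boot.
From mathcomp Require Import boolp classical_sets cardinality filter.

Set Implicit Arguments.
Unset Strict Implicit.
Unset Printing Implicit Defensive.

Local Open Scope classical_set_scope.

(** A kernel can be computed by recursion on any part of a digraph without long
walks: a vertex belongs to it exactly when none of its successors does. When
[A] has local finite height, this works around each finite set, but walks in
[A] may be unbounded, so that the recursion need not end on all of [A]. The kernel is therefore built in an elementary extension,
along an elementary chain [A = B_0, B_1, ...].

Stage [n] carries a successor-closed set [X_n] of vertices of [B_n] and a set
[K_n] that satisfies the kernel condition at each vertex of [X_n]
(initially [X_0] is empty). The next stage [B_{n+1}] is an ultrapower of [B_n]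
indexed by finite lists [F] of vertices together with their length, the
ultrafilter concentrating on long lists that contain any prescribed vertex
([listing_ultrafilter]). For each [F], the set [K_n] is kept on [X_n] and
extended by recursion through the closure of [F], which has only walks of
bounded length ([extend_kernel]); [K_{n+1}] is the ultraproduct of these
sets. It agrees with [K_n] on [X_n] and satisfies the kernel condition on the
successor-closure [X_{n+1}] of the image of [B_n], since a vertex of this
closure is represented by vertices that almost always lie well inside the
closure of the list ([stage_extend]).

Keeping every [X_n] successor-closed is what makes the limit work: when [K_n]
excludes a vertex of [X_n], the successor that justifies it lies in [X_n] too,
so it is never revised. Every vertex of [B_n] enters [X_{n+1}], its
membership is then final, and these final decisions together form a kernel of
the direct limit ([limit_kernelP]).

Both the ultrapowers and the direct limit are quotients of a set of sections
of a family of digraphs by equality on a filter, so one version of the theorem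
of Los ([reduced_los]) gives elementarity in both cases. *)

(** * Walks in closures of finite sets *)

Fixpoint walk (A : digraph) (C : set A) (k : nat) (x : A) : Prop :=
  C x /\ if k is k'.+1 then exists y, edge x y /\ walk C k' y else True.

(** Local finite height in the form used here. Finite sets are given by
enumerations [u] of length [n], so that a finite subset of an ultrapower lifts
to a family of finite sets, and the height is bounded through the absence of
walks, a condition refuted by positive existential data, which is what passes
from an ultrapower down to its factors. *)
Definition bounded_walks (A : digraph) : Prop :=
  forall n, exists k, forall (u : nat -> A) x, ~ walk (Cl n (u @` `I_n)) k x.

Lemma walk_shorten (A : digraph) (C : set A) h k x :
  h <= k -> walk C k x -> walk C h x.
Proof.
elim: h k x => [|h IHh] [|k] x //=; first by move=> _ [].
by move=> hk [Cx [y [xy Wy]]]; split=> //; exists y; split=> //; exact: IHh Wy.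
Qed.

(** The vertices of a walk all lie in [C], so that the walk is one of the
induced digraph. *)
Lemma walk_edge_pow (A : digraph) (C : set A) k x : walk C k x ->
  exists a b : induced C, proj1_sig a = x /\ edge_pow k a b.
Proof.
elim: k x => [|k IHk] x /= [Cx]; first by exists (exist _ x Cx), (exist _ x Cx).
move=> [y [xy /IHk[a [b [ay ab]]]]]; exists (exist _ x Cx), b; split=> //.
by exists a; split=> //; rewrite /= ay.
Qed.

Lemma local_finite_height_bounded_walks (A : digraph) :
  local_finite_height A -> bounded_walks A.
Proof.
move=> hA n; have [k hk] := hA n; exists k.+1 => u x wx.
have [h [hb _] le_hk] := hk _ (card_image_le u `I_n); apply: hb.
have /walk_edge_pow[a [b [_ ab]]] :=
  walk_shorten (h := h.+1) (k := k.+1) le_hk wx.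
by exists a, b.
Qed.

Lemma Cl_mono (A : digraph) (F : set A) m n : m <= n -> Cl m F `<=` Cl n F.
Proof.
elim: m n => [[|n] _ x Fx //|m IHm [|n] // mn x]; first by left.
case=> [Fx|[d Fd dx]]; [by left|right; exists d => //; exact: IHm Fd].
Qed.

Lemma Cl_step (A : digraph) (F : set A) n x y :
  Cl n F x -> edge x y -> Cl n.+1 F y.
Proof. by move=> Fx xy; right; exists x. Qed.

(** * Extending a kernel through a set of bounded walks *)

Definition successor_closed (A : digraph) (X : set A) : Prop :=
  forall a b : A, X a -> edge a b -> X b.

Definition kernel_at (A : digraph) (K : set A) (a : A) : Prop :=
  K a <-> forall b : A, edge a b -> ~ K b.

Section ExtendKernel.
Variables (A : digraph) (X K C : set A).

(** The recursion for a kernel that equals [K] on [X], cut off after [r] steps.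
Inside [C] the cut-off value is irrelevant as soon as [r] exceeds the length of
the walks, which replaces well-founded recursion. *)
Fixpoint approx_kernel (r : nat) (x : A) : Prop :=
  (X x /\ K x) \/ (~ X x /\
    if r is r'.+1 then
      forall y, C y -> edge x y -> ~ approx_kernel r' y
    else False).

Lemma approx_kernelX r x : X x -> approx_kernel r x <-> K x.
Proof. by case: r => [|r] Xx /=; split=> [[[]|[]]|]; auto. Qed.

Lemma approx_kernel_stable r s t x : C x -> ~ walk C r x -> r <= s -> r <= t ->
  approx_kernel s x -> approx_kernel t x.
Proof.
elim: r s t x => [|r IHr] [|s] [|t] x Cx nwalk //= rs rt; try by case: nwalk.
case=> [?|[nXx noK]]; [by left|right; split=> // y Cy xy Ky].
apply: (noK y Cy xy); apply: IHr Ky => // wy; apply: nwalk; split=> //.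
by exists y.
Qed.

(** The kernel condition can only be expected at vertices all of whose
successors are in [C], as the recursion ignores the others. On [X] the
condition is inherited from [K] because [X] is closed under successors. *)
Lemma extend_kernel k :
  successor_closed X -> (forall x, X x -> kernel_at K x) ->
  (forall x, ~ walk C k x) ->
  exists G : set A, (forall x, X x -> G x <-> K x) /\
    forall x, C x -> (forall y, edge x y -> C y) -> kernel_at G x.
Proof.
move=> Xcl KX nwalk; exists (approx_kernel k); split=> [x|x Cx succC].
  exact: approx_kernelX.
have [Xx|nXx] := pselect (X x).
  apply: iff_trans (approx_kernelX k Xx) (iff_trans (KX x Xx) _).
  by split=> noK y xy /(approx_kernelX k (Xcl _ _ Xx xy)); exact: noK.
have same : approx_kernel k x <-> approx_kernel k.+1 x.
  by split; apply: (@approx_kernel_stable k).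
apply: iff_trans same _; split=> /= [[[]//|[_ noK] y xy]|noK].
  exact: noK (succC y xy) xy.
by right; split=> // y _; exact: noK.
Qed.

End ExtendKernel.

(** * Reduced products of digraphs *)

Lemma env_cons_comp (S T : Type) (g : S -> T) n x (e : 'I_n -> S) :
  (fun v => g (env_cons x e v)) = env_cons (g x) (fun v => g (e v)).
Proof. by apply: funext => v; rewrite /env_cons; case: unlift. Qed.

(** Sections are indexed by a type [S] through [ev], so that [S] can be all
of the product (ultrapowers) or only some of it (direct limits). *)
Section ReducedProduct.
Variables (I : Type) (U : set_system I).
Context {FU : ProperFilter U}.
Variables (B : I -> digraph) (S : Type) (ev : S -> forall i, B i).

Definition same_germ (s t : S) : Prop := U [set i | ev s i = ev t i].

Definition germ : Type := {c : set S | exists s, c = same_germ s}.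

Definition class (s : S) : germ :=
  exist _ (same_germ s) (ex_intro _ s (erefl (same_germ s))).

Definition repr (q : germ) : S := projT1 (cid (proj2_sig q)).

Lemma reprK q : class (repr q) = q.
Proof.
rewrite /repr; case: q => c hc /=; case: (cid hc) => s /= cs.
by rewrite /class; apply: eq_exist; rewrite cs.
Qed.

Lemma class_eq s t : class s = class t <-> same_germ s t.
Proof.
split=> [[E]|st].
  by change (same_germ s t); rewrite E; exact: filterE.
apply: eq_exist; apply/predeqP => r; split=> [sr|tr].
  by move: st sr; apply: filterS2 => i; rewrite /= => <-.
by move: st tr; apply: filterS2 => i; rewrite /= => ->.
Qed.

Definition reduced_product : digraph :=
  @Digraph germ (fun q r => U [set i | edge (ev (repr q) i) (ev (repr r) i)]).

Definition reduced_set (P : forall i, set (B i)) : set reduced_product :=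
  fun q => U [set i | P i (ev (repr q) i)].

Let same_repr s : U [set i | ev (repr (class s)) i = ev s i].
Proof. by apply/(class_eq (repr (class s)) s); rewrite reprK. Qed.

Lemma class_edge s t : @edge reduced_product (class s) (class t) <->
  U [set i | edge (ev s i) (ev t i)].
Proof.
change (U [set i | edge (ev (repr (class s)) i) (ev (repr (class t)) i)] <->
  U [set i | edge (ev s i) (ev t i)]).
by split; move: (same_repr s) (same_repr t); apply: filterS3 => i /= -> ->.
Qed.

Lemma class_set (P : forall i, set (B i)) s :
  reduced_set P (class s) <-> U [set i | P i (ev s i)].
Proof.
rewrite /reduced_set.
by split; move: (same_repr s); apply: filterS2 => i /= ->.
Qed.

(** Only two facts are needed about the filter and the sections: each formula
holds or fails almost everywhere along given sections, and a universal formula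
that fails almost everywhere is refuted by some section. An ultrafilter gives
the first and the full product the second; for a chain of elementary
embeddings the first comes from elementarity. *)
Lemma reduced_los :
  (forall n (phi : formula n) (e : 'I_n -> S),
     U [set i | sat phi (fun v => ev (e v) i)] \/
     U [set i | ~ sat phi (fun v => ev (e v) i)]) ->
  (forall n (phi : formula n.+1) (e : 'I_n -> S),
     U [set i | ~ sat (All phi) (fun v => ev (e v) i)] ->
     exists s, U [set i | ~ sat phi (fun v => ev (env_cons s e v) i)]) ->
  forall n (phi : formula n) (e : 'I_n -> S),
    @sat reduced_product n phi (fun v => class (e v)) <->
    U [set i | sat phi (fun v => ev (e v) i)].
Proof.
move=> decide witness n phi.
elim: phi => {n} [n|n x y|n x y|n p IHp q IHq|n p IHp] e.
- by split=> //= /filter_const.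
- exact: class_eq.
- exact: class_edge.
- split=> /= [pq|pq /IHp p1]; last first.
    by apply/IHq; move: pq p1; apply: filterS2 => i /= pq /pq.
  have [/IHp/pq/IHq|] := decide _ p e; apply: filterS => i /=; first by [].
  by move=> np /np.
- split=> [all_p|all_p q].
    have [//|/witness[s ns]] := decide _ (All p) e.
    have /= := all_p (class s); rewrite -env_cons_comp => /IHp ys.
    by case: (filter_ex (filterI ns ys)) => i [].
  rewrite -(reprK q) -env_cons_comp; apply/IHp; move: all_p.
  apply: filterS => i /= /(_ (ev (repr q) i)).
  by rewrite -(env_cons_comp (ev^~ i)).
Qed.

(** Membership in a closure is witnessed by a path, and a path between classes
comes from paths in almost all factors. *)
Lemma reduced_Cl (F : set reduced_product) (P : forall i, set (B i)) :
  (forall s, F (class s) -> U [set i | P i (ev s i)]) ->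
  forall m s, Cl m F (class s) -> U [set i | Cl m (P i) (ev s i)].
Proof.
move=> FP; elim=> [|m IHm] s /=; first exact: FP.
case=> [/FP|[d Fd ds]]; first by apply: filterS; left.
move: Fd ds; rewrite -(reprK d) => /IHm Pd /class_edge.
by move: Pd; apply: filterS2 => i Pd ds; right; exists (ev (repr d) i).
Qed.

Lemma reduced_walk (C : set reduced_product) (P : forall i, set (B i)) :
  (forall s, C (class s) -> U [set i | P i (ev s i)]) ->
  forall k s, walk C k (class s) -> U [set i | walk (P i) k (ev s i)].
Proof.
move=> CP; elim=> [|k IHk] s /= [/CP Ps]; first by move=> _; apply: filterS Ps.
move=> [y []]; rewrite -(reprK y) => /class_edge sy /IHk wy.
move: Ps sy wy; apply: filterS3 => i Ps sy wy; split=> //.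
by exists (ev (repr y) i).
Qed.

End ReducedProduct.

(** A long walk in the reduced power near finitely many vertices would give one
in some factor near their representatives. *)
Lemma reduced_bounded_walks (A : digraph) (I : Type) (U : set_system I)
    {FU : ProperFilter U} (S : Type) (ev : S -> I -> A) :
  bounded_walks A -> bounded_walks (@reduced_product I U (fun=> A) S ev).
Proof.
move=> bA n; have [k hk] := bA n; exists k => u q.
rewrite -(reprK q); pose F i := (fun m => ev (repr (u m)) i) @` `I_n.
move=> wq.
have FP s : Cl n (u @` `I_n) (class U ev s) -> U [set i | Cl n (F i) (ev s i)].
  apply: (reduced_Cl (P := F)) => {}s [m mn].
  rewrite -{1}(reprK (u m)) => /class_eq.
  by apply: filterS => i E; exists m.
by have /filter_ex[i /hk] :=
  reduced_walk (FU := FU) (P := fun i => Cl n (F i)) FP wq.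
Qed.

(** * One step: an ultrapower with a kernel around the old vertices *)

Definition listed (A : Type) (j : (nat -> A) * nat) : set A := j.1 @` `I_j.2.

(** Concatenation makes the pairs (list, length) a directed preorder, whose
up-sets generate a proper filter. *)
Lemma listing_ultrafilter (A : Type) (a : A) :
  exists U : set_system ((nat -> A) * nat), UltraFilter U /\
    forall m x, U [set j | m <= j.2 /\ listed j x].
Proof.
pose above (j0 : (nat -> A) * nat) :=
  [set j : (nat -> A) * nat | j0.2 <= j.2 /\ listed j0 `<=` listed j].
have above_proper : ProperFilter (filter_from setT above).
  apply: filter_from_proper => [|j _]; last by exists j; split.
  apply: filter_from_filter => [|[u n] [v m] _ _]; first by exists (fun=> a, 0).
  exists (fun i => if i < n then u i else v (i - n), n + m) => //=.
  move=> -[w l] /= [nml sub].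
  split; split=> /=; [exact: leq_trans (leq_addr _ _) nml| |
                      exact: leq_trans (leq_addl _ _) nml|].
    move=> _ [i /= ltin <-]; apply: sub; exists i => /=; last by rewrite ltin.
    exact: ltn_addr.
  move=> _ [i /= ltim <-]; apply: sub; exists (n + i) => /=.
    by rewrite ltn_add2l.
  by rewrite ltnNge leq_addr addKn.
have [U [UU sU]] := ultraFilterLemma above_proper.
exists U; split=> // m x; apply: sU.
exists (fun=> x, m.+1) => // -[w l] [/= ml sub].
by split; [exact: ltnW|apply: sub; exists 0].
Qed.

(** A link of the chain: a digraph with a kernel that is already final on the
successor-closed set [dom] and provisional elsewhere. *)
Record stage := Stage {
  graph :> digraph;
  dom : set graph;
  ker : set graph;
  inhabitant : graph;
  stage_bounded : bounded_walks graph;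
  dom_closed : successor_closed dom;
  dom_kernel : forall x, dom x -> kernel_at ker x
}.

Definition extends (s t : stage) (f : s -> t) : Prop :=
  [/\ elementary_embedding f, forall x, dom (f x) &
      forall x, dom x -> ker (f x) <-> ker x].

Lemma los_ultrapower (A : digraph) (I : Type) (U : set_system I)
    (UU : UltraFilter U) (a : A) n (phi : formula n) (e : 'I_n -> I -> A) :
  let B := @reduced_product I U (fun=> A) (I -> A) id in
  @sat B n phi (fun v => class U id (e v)) <-> U [set i | sat phi (e^~ i)].
Proof.
move=> B; apply: (@reduced_los I U _ (fun=> A) (I -> A) id) => {}n {}phi {}e.
  exact: in_ultra_setVsetC.
move=> no_all.
have /choice[s hs] : forall i, exists x, ~ sat (All phi) (e^~ i) ->
    ~ sat phi (env_cons x (e^~ i)).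
  move=> i; have [?|/existsNP[x nx]] := pselect (sat (All phi) (e^~ i)).
    (* There is no counterexample at [i], so any vertex will do. *)
    by exists a.
  by exists x.
exists s; apply: filterS no_all => i /hs.
by rewrite -(env_cons_comp (fun t : I -> A => t i)).
Qed.

(** The new domain is the closure of the image of the old graph under all
finite numbers of successor steps. *)
Lemma stage_extend (s : stage) : exists (t : stage) (f : s -> t), extends f.
Proof.
have [U [UU hU]] := listing_ultrafilter (inhabitant s).
pose A := graph s; pose I := ((nat -> A) * nat)%type.
pose B := @reduced_product I U (fun=> A) (I -> A) id.
pose cls : (I -> A) -> B := class U id.
pose f (x : A) : B := cls (fun=> x).
(* With [m < j.2], successors of [Cl m] stay in the [j.2]-th closure. *)
have /choice[G hG] : forall j : I, exists G : set A,
    (forall x, dom x -> G x <-> ker x) /\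
    forall m x, m < j.2 -> Cl m (listed j) x -> kernel_at G x.
  case=> u n; have [k hk] := stage_bounded s n.
  have [G [GX GC]] := extend_kernel (@dom_closed s) (@dom_kernel s) (hk u).
  exists G; split=> // m x mn mx; apply: GC.
    exact: Cl_mono (ltnW mn) _ mx.
  by move=> y /(Cl_step mx); exact: Cl_mono.
pose Y : set B := fun q => exists m, Cl m (range f) q.
pose K : set B := @reduced_set I U (fun=> A) (I -> A) id G.
have fE : elementary_embedding f.
  move=> n phi e; apply: iff_sym.
  apply: iff_trans (los_ultrapower UU (inhabitant s) phi (fun v _ => e v)) _.
  by split=> [/filter_const|h] //; exact: filterE.
have Ycl : successor_closed Y.
  by move=> q r [m mq] qr; exists m.+1; exact: Cl_step qr.
have clsK x : K (cls x) <-> U [set j | G j (x j)] by exact: class_set.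
have clsE x y : edge (cls x) (cls y) <-> U [set j | edge (x j) (y j)].
  exact: class_edge.
have KY q : Y q -> kernel_at K q.
  case=> m; rewrite -(reprK q); move: (repr q) => {}q mq.
  have kq : U [set j | kernel_at (G j) (q j)].
    (* Almost every list contains a given vertex, hence [Cl m] of the image of
       [f] is almost everywhere inside [Cl m] of the list. *)
    have mj : U [set j | Cl m (listed j) (q j)].
      apply: (reduced_Cl (P := fun j : I => listed j)) mq => {}q [x _ /class_eq].
      move: (hU 0 x); apply: filterS2 => j [_ jx] /= <-; exact: jx.
    move: mj (hU m.+1 (inhabitant s)); apply: filterS2 => j mj [ltmj _].
    exact: (proj2 (hG j)) ltmj mj.
  split=> [/clsK Gq r|noK].
    rewrite -(reprK r); move: (repr r) => {}r /clsE qr /clsK Gr.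
    case: (filter_ex (filterI (filterI kq Gq) (filterI qr Gr))) => j.
    case=> -[kj Gqj] [qrj Grj].
    exact: (proj1 kj) Gqj _ qrj Grj.
  (* If the class of [q] were excluded, then so would almost all [q j], and the
     successors that justify this would form a section [r]. *)
  apply/clsK; have [//|nGq] := in_ultra_setVsetC [set j | G j (q j)] UU.
  have /choice[r hr] : forall j, exists y, kernel_at (G j) (q j) -> ~ G j (q j) ->
      edge (q j) y /\ G j y.
    move=> j; have [[y qy]|none] := pselect (exists y, edge (q j) y /\ G j y).
      by exists y.
    exists (q j) => kj nGj; case: nGj; apply/kj => y qy Gy.
    by apply: none; exists y.
  case: (noK (cls r)).
    by apply/clsE; move: kq nGq; apply: filterS2 => j kj /(hr j kj)[].
  by apply/clsK; move: kq nGq; apply: filterS2 => j kj /(hr j kj)[].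
have bB : bounded_walks B by exact: reduced_bounded_walks (@stage_bounded s).
exists (@Stage B Y K (f (inhabitant s)) bB Ycl KY), f.
split=> // [x|x Xx]; first by exists 0, x.
apply: iff_trans (clsK (fun=> x)) _.
split=> [/filter_ex[j /(proj1 (hG j) x Xx)]//|Kx].
by apply: filterE => j; apply/(proj1 (hG j) x Xx).
Qed.

(** * The limit of a chain of stages *)

Lemma elementary_edge (A B : digraph) (f : A -> B) (x y : A) :
  elementary_embedding f -> edge x y <-> edge (f x) (f y).
Proof.
move=> fE.
exact: (fE 2 (Rel ord0 ord_max) (fun i => if i == ord0 then x else y)).
Qed.

(** Elements of the direct limit are represented by threads, that is, sections
of the chain that eventually follow the embeddings, up to eventual equality.
Thus the limit is a reduced product for the Frechet filter on the stages, and
vertices of different stages never have to be transported to a common one. *)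
Section Limit.
Variables (s : nat -> stage) (f : forall n, s n -> s n.+1).
Hypothesis f_extends : forall n, extends (@f n).

Definition thread_from (N : nat) (x : forall n, s n) : Prop :=
  forall n, N <= n -> x n.+1 = f (x n).

Definition thread : Type := {x : forall n, s n | exists N, thread_from N x}.

Definition at_stage (x : thread) : forall n, s n := proj1_sig x.

(** The thread through [a] at stage [N]; its values below [N] are arbitrary. *)
Fixpoint spread (N : nat) (a : s N) (n : nat) : s n :=
  match pselect (n = N) with
  | left E => ecast n (s n) (esym E) a
  | right _ => match n with
     | 0 => inhabitant (s 0)
     | n'.+1 => f (spread a n')
     end
  end.

Lemma spread_at N (a : s N) : spread a N = a.
Proof. by case: N a => [|N] a /=; case: pselect => // E; rewrite eq_axiomK. Qed.

Lemma spread_from N (a : s N) : thread_from N (spread a).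
Proof.
by move=> n Nn /=; case: pselect => // E; rewrite -E ltnn in Nn.
Qed.

Definition thread_at N (a : s N) : thread :=
  exist _ (spread a) (ex_intro _ N (spread_from a)).

Lemma at_stage_thread_at N (a : s N) : at_stage (thread_at a) N = a.
Proof. exact: spread_at. Qed.

Lemma thread_uniform n (e : 'I_n -> thread) :
  exists N, forall v, thread_from N (at_stage (e v)).
Proof.
have /choice[N hN] : forall v, exists N, thread_from N (at_stage (e v)).
  by move=> v; exact: (proj2_sig (e v)).
exists (\max_v N v) => v m maxm; apply: hN.
exact: leq_trans (leq_bigmax v) maxm.
Qed.

Lemma eventually_from (P : nat -> Prop) N :
  (forall n, N <= n -> P n) -> \oo [set n | P n].
Proof. by exists N. Qed.

(** Along threads, from the stage where they all follow the embeddings, the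
truth value of a formula is constant by elementarity of each embedding. *)
Lemma sat_stable n (phi : formula n) (e : 'I_n -> thread) N m :
  (forall v, thread_from N (at_stage (e v))) -> N <= m ->
  sat phi (fun v => at_stage (e v) m) <-> sat phi (fun v => at_stage (e v) N).
Proof.
move=> eN; elim: m => [|m IHm]; first by rewrite leqn0 => /eqP ->.
rewrite leq_eqVlt => /orP[/eqP -> //|]; rewrite ltnS => Nm.
apply: iff_trans (IHm Nm); have [fE _ _] := f_extends m.
apply: iff_trans (iff_sym (fE _ phi _)).
by rewrite (_ : (fun v => _) = fun v => f (at_stage (e v) m)) //;
  apply: funext => v; exact: eN.
Qed.

Definition limit : digraph := @reduced_product nat \oo s thread at_stage.

(** A counterexample to a universal formula in a single late stage spreads to a
thread, and it stays one by stability. *)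
Lemma los_limit n (phi : formula n) (e : 'I_n -> thread) :
  @sat limit n phi (fun v => class \oo at_stage (e v)) <->
  \oo [set i | sat phi (fun v => at_stage (e v) i)].
Proof.
apply: reduced_los => {}n {}phi {}e; have [N eN] := thread_uniform e.
  have [p|np] := pselect (sat phi (fun v => at_stage (e v) N)); [left|right].
    by apply: (@eventually_from _ N) => m Nm; apply/(sat_stable phi eN Nm).
  by apply: (@eventually_from _ N) => m Nm /(sat_stable phi eN Nm).
move=> no_all.
have [M _ noM] := no_all.
pose N' := maxn M N.
have /existsNP[a na] := noM N' (leq_maxl M N).
exists (thread_at a); apply: (@eventually_from _ N') => m Nm.
have eN' v : thread_from N' (at_stage (env_cons (thread_at a) e v)).
  rewrite /env_cons; case: unlift => [w|]; last exact: spread_from.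
  by move=> k N'k; apply: eN; apply: leq_trans N'k; exact: leq_maxr.
move=> /(sat_stable phi eN' Nm).
by rewrite (env_cons_comp (at_stage ^~ N')) at_stage_thread_at.
Qed.

Lemma limit_elementary :
  elementary_embedding (fun a : s 0 => class \oo at_stage (thread_at a) : limit).
Proof.
move=> n phi e; apply: iff_sym.
apply: iff_trans (los_limit phi (fun v => thread_at (e v))) _.
have e0 v : thread_from 0 (at_stage (thread_at (e v))) by exact: spread_from.
have start : (fun v => at_stage (thread_at (e v)) 0) = e.
  by apply: funext => v; rewrite at_stage_thread_at.
have stable m : sat phi (fun v => at_stage (thread_at (e v)) m) <-> sat phi e.
  by rewrite -[X in _ <-> sat _ X]start; exact: (sat_stable phi e0).
split=> [/filter_ex[m /stable]//|p].
by apply: (@eventually_from _ 0) => m _; apply/stable.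
Qed.

Definition limit_kernel : set limit :=
  @reduced_set nat \oo s thread at_stage (fun n => @ker (s n)).

Lemma thread_dom N (x : forall n, s n) n :
  thread_from N x -> N < n -> dom (x n).
Proof.
by case: n => // n xN; rewrite ltnS => /xN ->; case: (f_extends n).
Qed.

(** A thread that has entered the domain never leaves it, and each stage keeps
the kernel of the previous one on the domain of that one. *)
Lemma thread_ker N (x : forall n, s n) n :
  thread_from N x -> dom (x N) -> N <= n -> ker (x n) <-> ker (x N).
Proof.
move=> xN xd; elim: n => [|n IHn]; first by rewrite leqn0 => /eqP ->.
rewrite leq_eqVlt => /orP[/eqP -> //|]; rewrite ltnS => Nn.
apply: iff_trans (IHn Nn); rewrite (xN n Nn); case: (f_extends n) => _ _; apply.
move: Nn; rewrite leq_eqVlt => /orP[/eqP <- //|]; exact: thread_dom.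
Qed.

(** A thread that follows the embeddings from stage [N] on is in the domain
from stage [N.+1] on, with a final status. If it is excluded there, the
successor responsible is also in the domain, so it is kept in all later
kernels and gives an element of the limit kernel. *)
Lemma limit_kernelP : kernel limit_kernel.
Proof.
move=> q; rewrite -(reprK q); move: (repr q) => {}q.
have clsK x : limit_kernel (class \oo at_stage x) <->
    \oo [set n | ker (at_stage x n)] by exact: class_set.
have clsE x y : @edge limit (class \oo at_stage x) (class \oo at_stage y) <->
    \oo [set n | edge (at_stage x n) (at_stage y n)] by exact: class_edge.
have [N qN] : exists N, thread_from N (at_stage q) by exact: (proj2_sig q).
have qN1 : thread_from N.+1 (at_stage q) by move=> n /ltnW; exact: qN.
have qd n : N < n -> dom (at_stage q n) by exact: thread_dom.
split=> [/clsK Kq r|noK].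
  rewrite -(reprK r); move: (repr r) => {}r /clsE qr /clsK Kr.
  have large : \oo [set n | N < n] by exact: (@eventually_from _ N.+1).
  case: (filter_ex (filterI (filterI Kq large) (filterI qr Kr))) => n.
  case=> -[Kqn /qd dq] [qrn Krn].
  exact: (proj1 (dom_kernel dq)) Kqn _ qrn Krn.
apply/clsK; apply: (@eventually_from _ N.+1) => n Nn.
apply/(thread_ker qN1 (qd _ (ltnSn N)) Nn); apply/(dom_kernel (qd _ (ltnSn N))).
move=> b qb Kb; apply: (noK (class \oo at_stage (thread_at b))).
  apply/clsE; apply: (@eventually_from _ N.+1); elim=> // m IHm.
  rewrite leq_eqVlt => /orP[/eqP <-|]; first by rewrite at_stage_thread_at.
  rewrite ltnS => Nm; have [fE _ _] := f_extends m.
  have -> : at_stage (thread_at b) m.+1 = f (at_stage (thread_at b) m).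
    exact: spread_from.
  rewrite (qN1 m Nm).
  exact: (proj1 (elementary_edge _ _ fE)) (IHm Nm).
apply/clsK; apply: (@eventually_from _ N.+1) => m Nm.
apply/(thread_ker (spread_from b) _ Nm); rewrite spread_at //.
exact: dom_closed (qd _ (ltnSn N)) qb.
Qed.

End Limit.

Theorem theorem2 (A : digraph) (hA : local_finite_height A) :
  exists B : digraph, elementary_extension A B /\ exists K : set B, kernel K.
Proof.
have [[a _]|noA] := pselect (exists a : A, True); last first.
  exists A; split; first by exists id.
  by exists set0 => a; case: noA; exists a.
pose s0 := @Stage A set0 set0 a (local_finite_height_bounded_walks hA)
  (fun _ _ => False_ind _) (fun _ => False_ind _).
pose next t := projT1 (cid (stage_extend t)).
pose s n := iter n next s0.
pose f n : s n -> s n.+1 := projT1 (cid (projT2 (cid (stage_extend (s n))))).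
have fP n : extends (@f n).
  exact: (projT2 (cid (projT2 (cid (stage_extend (s n)))))).
exists (limit f); split; last first.
  by exists (@limit_kernel s f); exact: limit_kernelP.
by eexists; exact: limit_elementary fP.
Qed.
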